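(* Let $X=\{\mathbf{x}_1,\dots,\mathbf{x}_n\}$ be an independent set of vectors in $\mathbb{R}^m$, let $\mathbf{y}\in\operatorname{span}X$ with $\mathbf{y}\neq\mathbf{0}$, and let $1\leq j\leq n$ be such that the set $Z$ obtained from $X$ by swapping $\mathbf{x}_j$ for $\mathbf{y}$ satisfies $\operatorname{span}Z=\operatorname{span}X$. Then $Z$ is also a set of independent vectors.
   Context: The setting is Bishop-style constructive mathematics (intuitionistic logic; the law of excluded middle is not available). For real numbers, $x\neq y$ means that $x$ and $y$ are apart: there is a rational $q>0$ with $|x-y|>q$. For vectors, $\mathbf{x}\neq\mathbf{y}$ means that some coordinate of $\mathbf{x}$ is apart from the corresponding coordinate of $\mathbf{y}$. Vectors $\mathbf{x}_1,\dots,\mathbf{x}_n$ are independent if for all $\beta\in\mathbb{R}^n$, $\beta\neq\mathbf{0}$ implies $\sum_i\beta_i\mathbf{x}_i\neq\mathbf{0}$. Finite sets of vectors are treated as indexed families. *)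

(* Defs.v *)
From Stdlib Require Import QArith Fin.
From Stdlib Require Import ConstructiveReals ConstructiveAbs.

(* Intuitionistic real numbers are the carrier of Stdlib's interface
   [ConstructiveReals], whose equality is the setoid [CReq].  Vectors are
   functions out of [Fin.t], compared coordinatewise with [CReq]. *)

Definition vec (R : ConstructiveReals) (m : nat) : Set :=
  Fin.t m -> CRcarrier R.

(* Prop-valued, unlike the library's [CRapart]; see [rapart_iff]. *)
Definition rapart {R : ConstructiveReals} (x y : CRcarrier R) : Prop :=
  exists q : Q, (0 < q)%Q /\
    CRltProp R (CR_of_Q R q) (CRabs R (CRminus R x y)).

Definition vapart {R : ConstructiveReals} {m : nat} (x y : vec R m) : Prop :=
  exists k : Fin.t m, rapart (x k) (y k).

Definition veq {R : ConstructiveReals} {m : nat} (x y : vec R m) : Prop :=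
  forall k : Fin.t m, CReq R (x k) (y k).

Definition vzero {R : ConstructiveReals} {m : nat} : vec R m :=
  fun _ => CR_of_Q R 0.

Fixpoint fsum {R : ConstructiveReals} {n : nat} :
    (Fin.t n -> CRcarrier R) -> CRcarrier R :=
  match n with
  | O => fun _ => CR_of_Q R 0
  | S n' => fun f => CRplus R (f Fin.F1) (fsum (fun i : Fin.t n' => f (Fin.FS i)))
  end.

Definition lincomb {R : ConstructiveReals} {n m : nat}
    (beta : vec R n) (X : Fin.t n -> vec R m) : vec R m :=
  fun k => fsum (fun i => CRmult R (beta i) (X i k)).

Definition in_span {R : ConstructiveReals} {n m : nat}
    (X : Fin.t n -> vec R m) (v : vec R m) : Prop :=
  exists alpha : vec R n, veq v (lincomb alpha X).

Definition independent {R : ConstructiveReals} {n m : nat}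
    (X : Fin.t n -> vec R m) : Prop :=
  forall beta : vec R n, vapart beta vzero -> vapart (lincomb beta X) vzero.

Definition swap {R : ConstructiveReals} {n m : nat}
    (X : Fin.t n -> vec R m) (j : Fin.t n) (y : vec R m) : Fin.t n -> vec R m :=
  fun i => if Fin.eq_dec i j then y else X i.

Lemma rapart_iff (R : ConstructiveReals) (x y : CRcarrier R) :
  rapart x y <-> inhabited (CRapart R x y).
Proof.
  split.
  - intros [q [Hq H]]. constructor.
    apply CRltEpsilon in H.
    assert (H0 : CRlt R (CR_of_Q R 0) (CRabs R (CRminus R x y))).
    { eapply CRlt_trans; [apply CR_of_Q_lt; exact Hq | exact H]. }
    apply CRabs_appart_0 in H0. destruct H0 as [H0|H0].
    + left. apply (CRplus_lt_reg_r (CRopp R y)).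
      rewrite CRplus_opp_r. exact H0.
    + right. apply (CRplus_lt_reg_r (CRopp R y)).
      rewrite CRplus_opp_r. exact H0.
  - assert (K : forall a b : CRcarrier R, CRlt R a b ->
      exists q : Q, (0 < q)%Q /\
        CRltProp R (CR_of_Q R q) (CRabs R (CRminus R b a))).
    { intros a b H.
      assert (H1 : CRlt R (CR_of_Q R 0) (CRminus R b a)).
      { apply (CRplus_lt_reg_r a). unfold CRminus.
        rewrite CRplus_0_l, CRplus_assoc, CRplus_opp_l, CRplus_0_r. exact H. }
      destruct (CR_Q_dense R _ _ H1) as [q [Hq0 Hq]]. exists q. split.
      - apply (lt_CR_of_Q R). exact Hq0.
      - apply CRltForget. eapply CRlt_le_trans; [exact Hq | apply CRle_abs]. }
    intros [[H|H]].
    + destruct (K _ _ H) as [q [Hq Hl]]. exists q. split; [exact Hq|].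
      apply CRltForget. rewrite CRabs_minus_sym. apply CRltEpsilon. exact Hl.
    + exact (K _ _ H).
Qed.

(* Main.v *)
Require Import Defs.
From Stdlib Require Import Fin ConstructiveReals.
From Stdlib Require Import QArith Ring Setoid ConstructiveAbs.

(** Write [y] as the combination of [X] with coefficients [alpha].  Substituting
    this into a combination of the swapped family turns its coefficients [beta]
    into coefficients with respect to [X] ([lincomb_swap]): entry [j] becomes
    [beta j * alpha j], and entry [i <> j] becomes [beta i + beta j * alpha i].
    Since [X] is independent, it is enough that this change of coefficients
    keeps [beta] apart from zero.

    It does so as soon as [alpha j] is apart from zero ([swap_coeffs_apart]).
    Suppose [beta k] is apart from zero.  If [k = j], then [beta j * alpha j] is
    apart from zero.  Otherwise [beta k] is the new coefficient at [k] minus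
    [beta j * alpha k], so the new coefficient at [k] or [beta j] is apart from
    zero, and the latter is the case already treated.

    That [alpha j] is apart from zero is what the equality of spans provides
    ([pivot_apart]).  The vector [X j] is a combination of the swapped family,
    hence also of [X], with [gamma j * alpha j] as its coefficient at [j].  As
    [X j] has coefficient [1] there, independence rules out that
    [1 - gamma j * alpha j] is apart from zero.  But
    [1 = (1 - gamma j * alpha j) + gamma j * alpha j] is apart from zero, so one
    of the two summands is, and it must be [gamma j * alpha j].

    All case distinctions on reals have this form: when a sum is apart from zero,
    so is a summand ([rapart_plus]). *)

Local Open Scope ConstructiveReals.

Section Swap.

Context {R : ConstructiveReals}.

(* The type makes [CRminus] the subtraction that [ring] recognises. *)
Add Ring CRring :
  (CRisRing R : ring_theory 0 1 (CRplus R) (CRmult R) (CRminus R) (CRopp R)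
                  (CReq R))
  (setoid (@CReq_rel R) (CRisRingExt R)).

(** A characterisation of apartness from zero by one inequality, from which
    compatibility with [CReq] and with products is inherited. *)
Lemma rapart_abs (x : CRcarrier R) :
  rapart x 0 <-> CRltProp R 0 (CRabs R x).
Proof.
  assert (E : CRabs R (x - 0) == CRabs R x) by (apply CRabs_morph; ring).
  split.
  - intros [q [Hq H]]. apply CRltForget. apply CRltEpsilon in H.
    rewrite E in H.
    exact (CRlt_trans _ _ _ (CR_of_Q_lt R 0 q Hq) H).
  - intro H. apply CRltEpsilon in H.
    destruct (CR_Q_dense R _ _ H) as [q [Hq0 Hq]]. exists q. split.
    + exact (lt_CR_of_Q R _ _ Hq0).
    + apply CRltForget. rewrite E. exact Hq.
Qed.

Lemma rapart_eq (x y : CRcarrier R) : x == y -> rapart x 0 -> rapart y 0.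
Proof.
  intros E H. apply rapart_abs. apply rapart_abs in H.
  apply CRltForget. apply CRltEpsilon in H.
  rewrite <- (CRabs_morph _ _ E). exact H.
Qed.

Lemma rapart_1_0 : rapart (R := R) 1 0.
Proof.
  apply rapart_iff. constructor. right. exact (CRzero_lt_one R).
Qed.

Lemma not_rapart_0_0 : ~ rapart (R := R) 0 0.
Proof.
  intro H. apply rapart_iff in H. destruct H as [[H|H]];
    exact (CRlt_asym _ _ H H).
Qed.

(** Comparing the intermediate value [x] with the endpoints of [0 < x + y]
    (or of [x + y < 0]) decides which summand is apart from zero. *)
Lemma rapart_plus (x y : CRcarrier R) :
  rapart (x + y) 0 -> rapart x 0 \/ rapart y 0.
Proof.
  assert (E : x == x + 0) by ring.
  intro H. apply rapart_iff in H. destruct H as [[H|H]].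
  - destruct (snd (CRltLinear R) _ x _ H) as [K|K].
    + right. apply rapart_iff. constructor. left.
      apply (CRplus_lt_reg_l R x). rewrite <- E. exact K.
    + left. apply rapart_iff. constructor. left. exact K.
  - destruct (snd (CRltLinear R) _ x _ H) as [K|K].
    + left. apply rapart_iff. constructor. right. exact K.
    + right. apply rapart_iff. constructor. right.
      apply (CRplus_lt_reg_l R x). rewrite <- E. exact K.
Qed.

Lemma rapart_mult (x y : CRcarrier R) :
  rapart x 0 -> rapart y 0 -> rapart (x * y) 0.
Proof.
  rewrite !rapart_abs. intros Hx Hy.
  apply CRltForget. apply CRltEpsilon in Hx. apply CRltEpsilon in Hy.
  rewrite CRabs_mult. exact (CRmult_lt_0_compat R _ _ Hx Hy).
Qed.

Lemma rapart_mult_l (x y : CRcarrier R) : rapart (x * y) 0 -> rapart x 0.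
Proof.
  rewrite (rapart_abs (x * y)). intro H. apply CRltEpsilon in H.
  rewrite CRabs_mult in H. apply CRmult_pos_appart_zero in H.
  apply rapart_abs, CRltForget. destruct H as [H|H].
  - exact H.
  - destruct (CRabs_pos x H).
Qed.

Lemma rapart_mult_r (x y : CRcarrier R) : rapart (x * y) 0 -> rapart y 0.
Proof.
  intro H. apply (rapart_mult_l y x). revert H. apply rapart_eq. ring.
Qed.

Lemma fsum_ext {n : nat} (f g : Fin.t n -> CRcarrier R) :
  (forall i, f i == g i) -> fsum f == fsum g.
Proof.
  induction n as [|n IH]; intro H; simpl.
  - reflexivity.
  - apply CRplus_morph; [apply H | apply IH; intro i; apply H].
Qed.

Lemma fsum_plus {n : nat} (f g : Fin.t n -> CRcarrier R) :
  fsum (fun i => f i + g i) == fsum f + fsum g.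
Proof.
  induction n as [|n IH]; simpl.
  - ring.
  - rewrite (IH (fun i => f (FS i)) (fun i => g (FS i))). ring.
Qed.

Lemma fsum_scale {n : nat} (c : CRcarrier R) (f : Fin.t n -> CRcarrier R) :
  fsum (fun i => c * f i) == c * fsum f.
Proof.
  induction n as [|n IH]; simpl.
  - ring.
  - rewrite (IH (fun i => f (FS i))). ring.
Qed.

Lemma fsum_single {n : nat} (j : Fin.t n) (c : CRcarrier R) :
  fsum (fun i => if Fin.eq_dec i j then c else 0) == c.
Proof.
  assert (Z : forall p, fsum (fun _ : Fin.t p => CR_of_Q R 0) == 0).
  { induction p as [|p IH]; simpl; [reflexivity | rewrite IH; ring]. }
  induction j as [n|n j IH].
  - cbn [fsum]. destruct (Fin.eq_dec F1 F1) as [_|N]; [|now destruct N].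
    rewrite (fsum_ext _ (fun _ => CR_of_Q R 0)).
    + rewrite Z. ring.
    + intro i. destruct (Fin.eq_dec (FS i) F1); [discriminate | reflexivity].
  - cbn [fsum]. destruct (Fin.eq_dec F1 (FS j)) as [D|_]; [discriminate|].
    rewrite (fsum_ext _ (fun i => if Fin.eq_dec i j then c else 0)).
    + rewrite IH. ring.
    + intro i.
      destruct (Fin.eq_dec (FS i) (FS j)) as [D|D], (Fin.eq_dec i j) as [D'|D'];
        try reflexivity.
      * destruct (D' (FS_inj _ _ D)).
      * destruct D. now f_equal.
Qed.

Lemma vapart_eq {m : nat} (v w : vec R m) :
  veq v w -> vapart v vzero -> vapart w vzero.
Proof.
  intros E [k H]. exists k. exact (rapart_eq _ _ (E k) H).
Qed.

Definition unit_vec {n : nat} (j : Fin.t n) : vec R n :=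
  fun i => if Fin.eq_dec i j then 1 else 0.

Lemma lincomb_unit {n m : nat} (X : Fin.t n -> vec R m) (j : Fin.t n) :
  veq (lincomb (unit_vec j) X) (X j).
Proof.
  intro k. unfold lincomb, unit_vec.
  rewrite <- (fsum_single j (X j k)) at 1. apply fsum_ext. intro i.
  destruct (Fin.eq_dec i j) as [->|_]; ring.
Qed.

(** Two expansions of one vector differ by an expansion of zero; over an
    apartness, uniqueness of coefficients takes this negative form. *)
Lemma independent_coeffs {n m : nat} (X : Fin.t n -> vec R m)
    (a b : vec R n) (i : Fin.t n) :
  independent X -> veq (lincomb a X) (lincomb b X) -> ~ rapart (a i - b i) 0.
Proof.
  intros HX E H.
  destruct (HX (fun i => a i - b i)) as [k Hk]; [now exists i|].
  apply not_rapart_0_0. revert Hk. apply rapart_eq.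
  unfold lincomb, vzero in *.
  transitivity (fsum (fun i => a i * X i k) + (- (1)) * fsum (fun i => b i * X i k)).
  - rewrite <- fsum_scale, <- fsum_plus. apply fsum_ext. intro l. ring.
  - rewrite (E k). ring.
Qed.

(** The coefficients with respect to [X] of the combination with coefficients
    [beta] of the family in which the combination with coefficients [alpha]
    has replaced [X j]. *)
Definition swap_coeffs {n : nat} (alpha : vec R n) (j : Fin.t n)
    (beta : vec R n) : vec R n :=
  fun i => beta j * alpha i + (if Fin.eq_dec i j then 0 else beta i).

Lemma lincomb_swap {n m : nat} (X : Fin.t n -> vec R m) (y : vec R m)
    (alpha beta : vec R n) (j : Fin.t n) :
  veq y (lincomb alpha X) ->
  veq (lincomb beta (swap X j y)) (lincomb (swap_coeffs alpha j beta) X).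
Proof.
  intros Hy k. unfold lincomb, swap_coeffs.
  (* Both sides are [beta j * y k] plus the terms of [beta] off [j]. *)
  transitivity (beta j * y k
    + fsum (fun i => (if Fin.eq_dec i j then 0 else beta i) * X i k)).
  - rewrite <- (fsum_single j (beta j * y k)), <- fsum_plus.
    apply fsum_ext. intro i. unfold swap.
    destruct (Fin.eq_dec i j) as [->|_]; ring.
  - rewrite (Hy k). unfold lincomb.
    rewrite <- fsum_scale, <- fsum_plus. apply fsum_ext. intro i. ring.
Qed.

(** Substituting the expansion of [y] into that of [X j] over the swapped family
    gives [X j] the coefficient [gamma j * alpha j] at [j]; by independence this
    product cannot be apart from [1], so it is apart from zero. *)
Lemma pivot_apart {n m : nat} (X : Fin.t n -> vec R m) (y : vec R m)
    (alpha : vec R n) (j : Fin.t n) :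
  independent X -> veq y (lincomb alpha X) -> in_span (swap X j y) (X j) ->
  rapart (alpha j) 0.
Proof.
  intros HX Hy [gamma Hg].
  assert (N : ~ rapart (unit_vec j j - swap_coeffs alpha j gamma j) 0).
  { apply (independent_coeffs X _ _ j HX). intro k.
    rewrite (lincomb_unit X j k), (Hg k). now apply lincomb_swap. }
  unfold unit_vec, swap_coeffs in N.
  destruct (Fin.eq_dec j j) as [_|D]; [|now destruct D].
  destruct (rapart_plus (1 - (gamma j * alpha j + 0)) (gamma j * alpha j))
    as [H|H].
  - apply (rapart_eq 1); [ring | exact rapart_1_0].
  - destruct (N H).
  - exact (rapart_mult_r _ _ H).
Qed.

(** The matrix of the change of coefficients is the identity with column [j]
    replaced by [alpha], so it is invertible once its pivot [alpha j] is apart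
    from zero; here this takes the form of strong injectivity. *)
Lemma swap_coeffs_apart {n : nat} (alpha beta : vec R n) (j : Fin.t n) :
  rapart (alpha j) 0 -> vapart beta vzero ->
  vapart (swap_coeffs alpha j beta) vzero.
Proof.
  intros Ha [k Hk]. unfold vzero in Hk.
  assert (J : rapart (beta j) 0 -> vapart (swap_coeffs alpha j beta) vzero).
  { intro Hj. exists j. unfold swap_coeffs, vzero.
    destruct (Fin.eq_dec j j) as [_|D]; [|now destruct D].
    apply (rapart_eq (beta j * alpha j)); [ring | now apply rapart_mult]. }
  destruct (Fin.eq_dec k j) as [->|D]; [exact (J Hk)|].
  destruct (rapart_plus (beta j * alpha k + beta k) (beta j * (- alpha k)))
    as [H|H].
  - apply (rapart_eq (beta k)); [ring | exact Hk].
  - exists k. unfold swap_coeffs, vzero.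
    destruct (Fin.eq_dec k j) as [D'|_]; [now destruct D | exact H].
  - exact (J (rapart_mult_l _ _ H)).
Qed.

End Swap.

Theorem lemma3p7 : forall (R : ConstructiveReals) (n m : nat)
    (X : Fin.t n -> vec R m) (y : vec R m) (j : Fin.t n),
  independent X ->
  in_span X y ->
  vapart y vzero ->
  (forall v : vec R m, in_span (swap X j y) v <-> in_span X v) ->
  independent (swap X j y).
Proof.
  intros R n m X y j HX [alpha Hy] _ Hspan beta Hb.
  assert (Ha : rapart (alpha j) (CR_of_Q R 0)).
  { apply (pivot_apart X y alpha j HX Hy). apply Hspan.
    exists (unit_vec j). intro k. symmetry. apply lincomb_unit. }
  apply (vapart_eq (lincomb (swap_coeffs alpha j beta) X)).
  - intro k. symmetry. now apply lincomb_swap.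
  - apply HX. now apply swap_coeffs_apart.
Qed.
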